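(* Let $\mathcal{X}$ be a separable infinite-dimensional complex Hilbert space (or, in the finite-dimensional case, suppose $\mathcal{X}\cong\mathbb{C}^d$). Suppose $A\in\mathcal{L}(\mathcal{X})$ is diagonalizable in the sense that there is a linear, bounded map $V:l^2\to\mathcal{X}$ (respectively $V:\mathbb{C}^d\to\mathcal{X}$) with bounded inverse and a diagonal (in the standard basis) operator $\Lambda\in\mathcal{L}(l^2)$ (respectively $\Lambda\in\mathbb{C}^{d\times d}$) such that $A=V\Lambda V^{-1}$. If $B\in\mathcal{L}(\mathcal{X})$ and if $Bx=\mu x$ for $\mu\in\mathbb{C}$ and $x\in\mathcal{X}$ with $\|x\|=1$, then $$\min_{\lambda\in\sigma(A)}|\mu-\lambda|\le\|V\|\,\|V^{-1}\|\,\|(B-A)x\|.$$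
   Context: $\mathcal{L}(\mathcal{X})$ denotes the bounded linear operators on $\mathcal{X}$; $\sigma(A)$ is the spectrum of $A$. $l^2$ is the Hilbert space of square-summable complex sequences with standard basis $\delta_j$; $\Lambda\in\mathcal{L}(l^2)$ is diagonal in the standard basis if for each $j$, $\Lambda\delta_j=\lambda_j\delta_j$ for some $\lambda_j\in\mathbb{C}$. $\|V\|$ and $\|V^{-1}\|$ are the operator norms between $l^2$ (respectively $\mathbb{C}^d$ with the Euclidean norm) and $\mathcal{X}$. *)

(* Defs.v *)
From HB Require Import structures.
From mathcomp Require Import all_boot all_order all_algebra.
From mathcomp Require Import complex.
From mathcomp Require Import all_classical all_reals all_analysis.

Set Implicit Arguments.
Unset Strict Implicit.
Unset Printing Implicit Defensive.

Import Order.TTheory GRing.Theory Num.Theory.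
Import numFieldNormedType.Exports.

Local Open Scope classical_set_scope.
Local Open Scope ring_scope.
Local Open Scope complex_scope.

(* [inner] is linear in its first argument and conjugate-linear in the second. *)
HB.mixin Record NormedModule_isHilbert (R : realType) V
    & CompleteNormedModule R[i] V := {
  inner : {dot V for (@Num.conj R[i])} ;
  inner_norm : forall x : V, inner x x = `|x| ^+ 2 }.

#[short(type="hilbertType")]
HB.structure Definition Hilbert (R : realType) :=
  {V of CompleteNormedModule R[i] V & NormedModule_isHilbert R V}.

Definition separable (T : topologicalType) :=
  exists2 S : set T, countable S & dense S.

Definition finite_dimensional (K : nzRingType) (V : lmodType K) :=
  exists n (e : 'I_n -> V), forall x,
    exists c : 'I_n -> K, x = \sum_(i < n) c i *: e i.

Section Operators.
Context {R : realType}.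

Definition bounded_op (V W : normedModType R[i]) (f : V -> W) :=
  exists M : R, forall x, `|f x| <= M%:C * `|x|.

(* The norm of a normed module over [R[i]] takes (real nonnegative) values in
   [R[i]], hence the [complex.Re]. Meaningful only for bounded operators: the
   supremum of an unbounded set is 0. *)
Definition opnorm (V W : normedModType R[i]) (f : V -> W) : R :=
  sup [set complex.Re `|f x| | x in [set x : V | `|x| <= 1]].

Definition spectrum (V : normedModType R[i]) (A : V -> V) : set R[i] :=
  [set lam | ~ exists S : {linear V -> V},
    [/\ bounded_op S, cancel (fun x => A x - lam *: x) S
      & cancel S (fun x => A x - lam *: x)]].

End Operators.

Section EuclideanMinkowski.
Variable R : realType.
Implicit Types a b : R[i].

Definition cabs (z : R[i]) : R := complex.Re `|z|.

Lemma cabsE a : `|a| = (cabs a)%:C.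
Proof. by rewrite /cabs normc_def. Qed.

Lemma cabs_ge0 a : 0 <= cabs a.
Proof. by rewrite -lecR -cabsE normr_ge0. Qed.

Lemma cabsD a b : cabs (a + b) <= cabs a + cabs b.
Proof. by rewrite -lecR rmorphD/= -!cabsE ler_normD. Qed.

Lemma cabsM a b : cabs (a * b) = cabs a * cabs b.
Proof. by apply: (@complexI R); rewrite rmorphM/= -!cabsE normrM. Qed.

Lemma cabs_eq0 a : cabs a = 0 -> a = 0.
Proof. by move=> a0; apply/eqP; rewrite -normr_eq0 cabsE a0. Qed.

Lemma sqrt_minkowski2 (p q x y : R) :
  Num.sqrt ((p + q) ^+ 2 + (x + y) ^+ 2) <=
  Num.sqrt (p ^+ 2 + x ^+ 2) + Num.sqrt (q ^+ 2 + y ^+ 2).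
Proof.
have := ler_normD (p +i* x) (q +i* y).
by rewrite !normc_def -rmorphD/= lecR.
Qed.

Lemma minkowski_seq (I : Type) (s : seq I) (f g : I -> R[i]) :
  Num.sqrt (\sum_(i <- s) cabs (f i + g i) ^+ 2) <=
  Num.sqrt (\sum_(i <- s) cabs (f i) ^+ 2) +
  Num.sqrt (\sum_(i <- s) cabs (g i) ^+ 2).
Proof.
have sge0 (h : I -> R[i]) t : 0 <= \sum_(i <- t) cabs (h i) ^+ 2.
  by apply: sumr_ge0 => i _; exact: sqr_ge0.
elim: s => [|i s IH]; first by rewrite !big_nil sqrtr0 addr0.
rewrite !big_cons !(addrC (cabs _ ^+ 2)).
rewrite -(sqr_sqrtr (sge0 f s)) -(sqr_sqrtr (sge0 g s)).
apply: le_trans (sqrt_minkowski2 _ _ _ _).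
rewrite ler_wsqrtr// lerD//.
  rewrite -[leLHS]sqr_sqrtr ?sge0// lerXn2r ?nnegrE ?addr_ge0 ?sqrtr_ge0//.
by rewrite lerXn2r ?nnegrE ?addr_ge0 ?cabs_ge0 ?cabsD.
Qed.

End EuclideanMinkowski.

(* The canonical norm on matrices is the sup norm, so C^d with its Euclidean
   norm is an alias of the column vectors with its own normed structure. *)
Definition Cvec (R : realType) (d : nat) : Type := 'cV[R[i]]_d.

Section Cvec.
Variables (R : realType) (d : nat).
Implicit Types x y : Cvec R d.

HB.instance Definition _ := GRing.Lmodule.copy (Cvec R d) 'cV[R[i]]_d.

Definition Cvec_norm x : R := Num.sqrt (\sum_(i < d) cabs (x i 0) ^+ 2).

Lemma Cvec_normD x y :
  (Cvec_norm (x + y))%:C <= (Cvec_norm x)%:C + (Cvec_norm y)%:C :> R[i].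
Proof.
rewrite -rmorphD/= lecR; apply: le_trans (minkowski_seq _ _ _).
by rewrite /Cvec_norm; under eq_bigr do rewrite mxE.
Qed.

Lemma Cvec_normZ (l : R[i]) x :
  (Cvec_norm (l *: x))%:C = `|l| * (Cvec_norm x)%:C.
Proof.
rewrite cabsE -rmorphM/=; congr (_%:C).
rewrite /Cvec_norm; under eq_bigr do rewrite mxE cabsM exprMn.
by rewrite -mulr_sumr sqrtrM ?sqr_ge0// sqrtr_sqr ger0_norm ?cabs_ge0.
Qed.

Lemma Cvec_norm0_eq0 x : (Cvec_norm x)%:C = 0 :> R[i] -> x = 0.
Proof.
move=> [/eqP]; rewrite sqrtr_eq0 => x0.
have {}x0 : \sum_(i < d) cabs (x i 0) ^+ 2 = 0.
  by apply/eqP; rewrite eq_le x0 sumr_ge0// => i _; exact: sqr_ge0.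
apply/colP => i; rewrite mxE.
apply: cabs_eq0; apply/eqP; rewrite -sqrf_eq0; apply/eqP.
by apply: (psumr_eq0P _ x0) => // j _; exact: sqr_ge0.
Qed.

HB.instance Definition _ := @Lmodule_isNormed.Build R[i] (Cvec R d)
  (fun x => (Cvec_norm x)%:C) Cvec_normD Cvec_normZ Cvec_norm0_eq0.

Lemma Cvec_normE x : `|x| = (Num.sqrt (\sum_(i < d) cabs (x i 0) ^+ 2))%:C.
Proof. by []. Qed.

End Cvec.

Definition square_summable (R : realType) : {pred nat -> R[i]} :=
  fun x => `[< cvgn (series (fun k => cabs (x k) ^+ 2)) >].

Record l2 (R : realType) := L2 {
  l2_seq :> nat -> R[i] ;
  l2_seqP : l2_seq \in @square_summable R }.

Section l2.
Variable R : realType.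

HB.instance Definition _ := [isSub for @l2_seq R].
HB.instance Definition _ := [Choice of l2 R by <:].

Let psum (x : nat -> R[i]) := series (fun k => cabs (x k) ^+ 2).

Let psum_ge0 x n : 0 <= psum x n.
Proof. by apply: sumr_ge0 => i _; exact: sqr_ge0. Qed.

Let psum_nd x : nondecreasing_seq (psum x).
Proof. by apply: nondecreasing_series => n _ _; exact: sqr_ge0. Qed.

Let psum_le x n : cvgn (psum x) -> psum x n <= limn (psum x).
Proof. by move=> cx; exact: nondecreasing_cvgn_le. Qed.

Let psumZ (l : R[i]) x : psum (l *: x) = cabs l ^+ 2 *: psum x.
Proof.
apply/funext => n; rewrite /psum /series/=.
rewrite [RHS]mulr_sumr.
by apply: eq_bigr => k _; rewrite cabsM exprMn.
Qed.

Let psum_sqrtD x y n : cvgn (psum x) -> cvgn (psum y) ->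
  psum (x + y) n <=
  (Num.sqrt (limn (psum x)) + Num.sqrt (limn (psum y))) ^+ 2.
Proof.
move=> cx cy; rewrite -[leLHS]sqr_sqrtr ?psum_ge0//.
rewrite lerXn2r ?nnegrE ?addr_ge0 ?sqrtr_ge0//.
apply: le_trans (minkowski_seq _ _ _) _.
by rewrite lerD// ler_wsqrtr// psum_le.
Qed.

Lemma square_summable_submod : submod_closed (@square_summable R).
Proof.
split.
  rewrite unfold_in; apply/asboolP.
  rewrite (_ : series _ = cst 0); first exact: is_cvg_cst.
  apply/funext => n; rewrite /series/= big1// => k _.
  by rewrite /cabs normr0 expr0n.
move=> l x y; rewrite !unfold_in => /asboolP cx /asboolP cy; apply/asboolP.
have clx : cvgn (psum (l *: x)) by rewrite psumZ; exact: is_cvgZr.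
apply: nondecreasing_is_cvgn; first exact: psum_nd.
eexists => _ [n _ <-]; exact: psum_sqrtD.
Qed.

HB.instance Definition _ :=
  GRing.isSubmodClosed.Build _ _ (@square_summable R) square_summable_submod.
HB.instance Definition _ := [SubChoice_isSubLmodule of l2 R by <:].

Definition l2_norm (x : l2 R) : R :=
  Num.sqrt (limn (series (fun k => cabs (x k) ^+ 2))).

Let l2_cvg (x : l2 R) : cvgn (psum x).
Proof. by have := l2_seqP x; rewrite unfold_in => /asboolP. Qed.

Lemma l2_normD (x y : l2 R) :
  (l2_norm (x + y))%:C <= (l2_norm x)%:C + (l2_norm y)%:C :> R[i].
Proof.
rewrite -rmorphD/= lecR.
rewrite -[leRHS]ger0_norm ?addr_ge0 ?sqrtr_ge0// -sqrtr_sqr ler_wsqrtr//.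
apply: limr_le; first exact: l2_cvg.
by near=> n; apply: psum_sqrtD; exact: l2_cvg.
Unshelve. all: end_near. Qed.

Lemma l2_normZ (l : R[i]) (x : l2 R) :
  (l2_norm (l *: x))%:C = `|l| * (l2_norm x)%:C.
Proof.
rewrite cabsE -rmorphM/=; congr (_%:C); rewrite /l2_norm -/(psum _) -/(psum x).
rewrite (_ : psum _ = cabs l ^+ 2 *: psum x); last exact: psumZ.
rewrite limZr; last exact: l2_cvg.
by rewrite sqrtrM ?sqr_ge0// sqrtr_sqr ger0_norm ?cabs_ge0.
Qed.

Lemma l2_norm0_eq0 (x : l2 R) : (l2_norm x)%:C = 0 :> R[i] -> x = 0.
Proof.
move=> [/eqP]; rewrite sqrtr_eq0 => x0.
apply/val_inj/funext => k /=; apply: cabs_eq0; apply/eqP.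
rewrite -sqrf_eq0 eq_le sqr_ge0 andbT.
apply: le_trans x0; apply: (@le_trans _ _ (psum x k.+1)); last first.
  by apply: psum_le; exact: l2_cvg.
by rewrite /psum /series/= big_nat_recr//= lerDr psum_ge0.
Qed.

HB.instance Definition _ := @Lmodule_isNormed.Build R[i] (l2 R)
  (fun x => (l2_norm x)%:C) l2_normD l2_normZ l2_norm0_eq0.

Lemma l2_normE (x : l2 R) :
  `|x| = (Num.sqrt (limn (series (fun k => cabs (x k) ^+ 2))))%:C.
Proof. by []. Qed.

Lemma l2_delta_subproof (j : nat) :
  (fun k => (k == j)%:R : R[i]) \in @square_summable R.
Proof.
rewrite unfold_in; apply/asboolP/nondecreasing_is_cvgn; first exact: psum_nd.
exists 1 => _ [n _ <-]; rewrite /series/=.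
rewrite (eq_bigr (fun k => (k == j)%:R)); last first.
  by move=> k _; case: eqP; rewrite /cabs ?normr1 ?normr0 ?expr1n ?expr0n.
elim: n => [|n IH]; first by rewrite big_geq.
have [/eqP jn|nj] := boolP (n == j); last first.
  by rewrite big_nat_recr//= (negbTE nj) addr0.
rewrite big_nat_recr//= jn eqxx big_nat big1 ?add0r// => k /andP[_ kj].
by rewrite ltn_eqF.
Qed.

Definition l2_delta (j : nat) : l2 R := L2 (l2_delta_subproof j).

Definition l2_diagonal (Lam : l2 R -> l2 R) :=
  forall j, exists lam : R[i], Lam (l2_delta j) = lam *: l2_delta j.

End l2.

(* Main.v *)
Require Import Defs.
From HB Require Import structures.
From mathcomp Require Import all_boot all_order all_algebra.
From mathcomp Require Import complex.
From mathcomp Require Import all_classical all_reals all_analysis.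

(** This is the Bauer-Fike argument. Write [L] for the diagonal operator with
    diagonal [l], so that [A = V L Vinv], and put [y = Vinv x]. Since
    [(L - mu) y = Vinv ((A - B) x)] and [L - mu] is diagonal, that vector has
    norm at least [delta * |y|], where [delta] is the infimum of the [|mu - l i|]; as
    [1 = |V y|] is at most [|V| * |y|], it follows that [delta] is at most
    [|V| * |Vinv| * |(B - A) x|].

    It remains to see that [delta] is the distance from [mu] to the spectrum and
    is attained there. By compactness there is a point [lam] in the closure of
    the eigenvalues with [|mu - lam| = delta] ([nearest_adherent_point]). It is
    spectral, because eigenvectors for eigenvalues close to [lam] are
    approximate eigenvectors for [lam] ([approx_eigenvalue_spectrum]).
    Conversely a point [nu] closer to [mu] than [delta] stays away from all
    eigenvalues, so that [L - nu] is inverted by the bounded diagonal operator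
    with entries [1 / (l i - nu)], and [nu] lies outside the spectrum of [L],
    hence of [A] ([bounded_below_onto_not_spectrum], [spectrum_similar]).

    The argument is run once, in [bauer_fike], for an operator with the three
    properties of [eigenvalue_controlled]. Those are checked coordinate by
    coordinate for diagonal matrices and for diagonal operators on
    square-summable sequences; in the latter case the coordinate formula for [L]
    has first to be extended from finite combinations of the basis vectors to
    the whole space by continuity ([l2_diagonal_coord]). *)

Set Implicit Arguments.
Unset Strict Implicit.
Unset Printing Implicit Defensive.

Import Order.TTheory GRing.Theory Num.Theory.
Import numFieldNormedType.Exports.

Local Open Scope classical_set_scope.
Local Open Scope ring_scope.
Local Open Scope complex_scope.

(** * Norms valued in the complex numbers *)

Section ComplexNorm.
Context {R : realType}.

Lemma ge0_Re_complex (z : R[i]) : 0 <= z -> z = (complex.Re z)%:C.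
Proof. by case: z => a b; rewrite lecE/= => /andP[/eqP -> _]. Qed.

Lemma norm_ReE (V : normedModType R[i]) (x : V) : `|x| = (complex.Re `|x|)%:C.
Proof. exact: ge0_Re_complex. Qed.

Lemma cabs_le_ReIm (z : R[i]) :
  cabs z <= `|complex.Re z| + `|complex.Im z|.
Proof.
case: z => a b /=; have -> : a +i* b = a%:C + (0 +i* b).
  by apply/eqP; rewrite eq_complex/= addr0 add0r !eqxx.
apply: le_trans (cabsD _ _) _.
by rewrite /cabs !normc_def/= expr0n/= add0r addr0 !sqrtr_sqr.
Qed.

Lemma cabs_ge_Re (z : R[i]) : `|complex.Re z| <= cabs z.
Proof. by rewrite -lecR -cabsE normc_ge_Re. Qed.

Lemma cabs_ge_Im (z : R[i]) : `|complex.Im z| <= cabs z.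
Proof.
rewrite /cabs normc_def/= -sqrtr_sqr ler_wsqrtr//.
by rewrite lerDr sqr_ge0.
Qed.

Lemma cabsN (z : R[i]) : cabs (- z) = cabs z.
Proof. by rewrite /cabs normrN. Qed.

(** A minimising sequence for the distance to [mu] is bounded, so it clusters;
    the plane is handled as [R * R], whose rectangles are compact. *)
Lemma nearest_adherent_point (I : Type) (i0 : I) (l : I -> R[i]) (mu : R[i]) :
  exists lam, (forall e : R, 0 < e -> exists i, cabs (l i - lam) < e) /\
              (forall i, cabs (mu - lam) <= cabs (mu - l i)).
Proof.
pose D := [set cabs (mu - l i) | i in [set: I]].
have Dlb : lbound D 0 by move=> _ [i _ <-]; exact: cabs_ge0.
have Dinf : has_inf D by split; [exists (cabs (mu - l i0)), i0 | exists 0].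
pose S (e : R) := [set p : R * R |
  exists2 i, p = (complex.Re (l i), complex.Im (l i)) &
             cabs (mu - l i) < inf D + e].
have FF : ProperFilter (filter_from [set e : R | 0 < e] S).
  apply: filter_from_proper; last first.
    move=> e e0; have [_ [i _ <-] lie] := inf_adherent e0 Dinf.
    by exists (complex.Re (l i), complex.Im (l i)), i.
  apply: filter_from_filter; first by exists 1 => /=; exact: ltr01.
  move=> a b a0 b0; exists (Num.min a b); first by rewrite /= lt_min a0.
  move=> _ [i -> li]; split; exists i => //; apply: lt_le_trans li _;
    by rewrite lerD2l ge_min lexx ?orbT.
(* Points within [inf D + 1] of [mu] lie in the square [K] around [mu]. *)
pose r := inf D + 1.
pose K := `[complex.Re mu - r, complex.Re mu + r]%classic `*`
          `[complex.Im mu - r, complex.Im mu + r]%classic.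
have cK : compact K by apply: compact_setX; exact: segment_compact.
have FK : filter_from [set e : R | 0 < e] S K.
  exists 1; first exact: ltr01.
  move=> _ [i -> /ltW li]; split => /=; rewrite in_itv/= -ler_distlC.
    by apply: le_trans li; rewrite -raddfB; exact: cabs_ge_Re.
  by apply: le_trans li; rewrite -raddfB; exact: cabs_ge_Im.
have [[a b] [_ clp]] := cK _ FF FK.
have approach (e : R) : 0 < e ->
    exists2 i, cabs (l i - (a +i* b)) < e & cabs (mu - l i) < inf D + e.
  move=> e0; have e20 : 0 < e / 2 by rewrite divr_gt0.
  have [||q [[i -> li] [/= qa qb]]] :=
    clp (S e) (ball (a, b) (e / 2)); [by exists e | exact: nbhsx_ballx |].
  exists i => //; apply: le_lt_trans (cabs_le_ReIm _) _.
  rewrite !raddfB/= (splitr e) ltrD// distrC.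
    exact: qa.
  exact: qb.
exists (a +i* b); split=> [e e0|i].
  by have [i li _] := approach e e0; exists i.
have Di : inf D <= cabs (mu - l i) by apply: ge_inf; [exists 0 | exists i].
apply: le_trans Di; apply/ler_addgt0Pr => e e0.
have [|j j1 j2] := approach (e / 2); first by rewrite divr_gt0.
have -> : mu - (a +i* b) = (mu - l j) + (l j - (a +i* b)).
  by rewrite addrA subrK.
apply: le_trans (cabsD _ _) _.
by rewrite [in leRHS](splitr e) addrA ltW// ltrD.
Qed.

End ComplexNorm.

(** * Bounded operators and their spectra *)

Section BoundedOperators.
Context {R : realType}.
Implicit Types U V W : normedModType R[i].

Lemma bounded_op_ge0 V W (f : V -> W) : bounded_op f ->
  exists2 M : R, 0 <= M & forall x, `|f x| <= M%:C * `|x|.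
Proof.
move=> [M fM]; exists `|M| => // x; apply: le_trans (fM x) _.
by rewrite ler_wpM2r// lecR ler_norm.
Qed.

Lemma bounded_op_comp U V W (f : V -> W) (g : U -> V) :
  bounded_op f -> bounded_op g -> bounded_op (f \o g).
Proof.
move=> /bounded_op_ge0[M M0 fM] [N gN]; exists (M * N) => x /=.
apply: le_trans (fM _) _.
by rewrite rmorphM/= -mulrA ler_wpM2l// lecR.
Qed.

Lemma opnorm_ub V W (f : V -> W) (x : V) : bounded_op f ->
  `|x| <= 1 -> complex.Re `|f x| <= opnorm f.
Proof.
move=> /bounded_op_ge0[M M0 fM] x1; apply: ub_le_sup; last by exists x.
exists M => _ [y /= y1 <-]; rewrite -lecR -norm_ReE.
apply: le_trans (fM y) _.
by rewrite -[leRHS]mulr1 ler_wpM2l// lecR.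
Qed.

Lemma opnorm_ge0 V W (f : V -> W) : bounded_op f -> 0 <= opnorm f.
Proof.
move=> bf; have := opnorm_ub (x := 0) bf; rewrite normr0 => /(_ ler01).
apply: le_trans; rewrite -lecR -norm_ReE; exact: normr_ge0.
Qed.

Lemma opnormP V W (f : {linear V -> W}) : bounded_op f ->
  forall x, `|f x| <= (opnorm f)%:C * `|x|.
Proof.
move=> bf x.
have [->|x0] := eqVneq x 0; first by rewrite linear0 !normr0 mulr0.
(* By homogeneity the bound on the unit ball at [x / |x|] suffices. *)
rewrite -ler_pdivrMr ?normr_gt0// mulrC.
have nx : 0 <= `|x|^-1 by rewrite invr_ge0.
rewrite -[`|x|^-1]ger0_norm// -normrZ -linearZ/= norm_ReE lecR.
apply: opnorm_ub => //.
by rewrite normrZ ger0_norm// mulVf// normr_eq0.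
Qed.

(** Approximate eigenvalues are spectral: a bounded left inverse of [A - lam]
    with bound [M] forces [1 <= M * e] on an [e]-approximate eigenvector. *)
Lemma approx_eigenvalue_spectrum V (A : V -> V) (lam : R[i]) :
  (forall e : R, 0 < e ->
     exists2 x, x != 0 & `|A x - lam *: x| <= e%:C * `|x|) ->
  spectrum A lam.
Proof.
move=> ape [S [/bounded_op_ge0[M M0 SM] AS _]].
(* [M + 1] rather than [M], which may vanish. *)
have M1 : 0 < M + 1 by rewrite ltr_wpDl.
have [|x x0 xe] := ape (M + 1)^-1; first by rewrite invr_gt0.
have : `|x| <= M%:C * ((M + 1)^-1%:C * `|x|).
  rewrite -{1}(AS x); apply: le_trans (SM _) _.
  by rewrite ler_wpM2l// lecR.
rewrite mulrA -rmorphM/= -[leLHS]mul1r ler_pM2r ?normr_gt0//.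
rewrite lecR ler_pdivlMr// mul1r leNgt.
by rewrite ltrDl ltr01.
Qed.

(** The lower bound makes [A - lam] injective, and it is also the bound
    [1 / c] on the inverse. *)
Lemma bounded_below_onto_not_spectrum V (A : {linear V -> V}) (lam : R[i])
    (c : R) : 0 < c ->
  (forall x, c%:C * `|x| <= `|A x - lam *: x|) ->
  (forall y, exists x, A x - lam *: x = y) ->
  ~ spectrum A lam.
Proof.
move=> c0 below onto; apply; have [g gK] := choice onto.
have c0' : 0 < c%:C by rewrite ltcR.
pose T : {linear V -> V} := A \- lam *: idfun.
have TE x : T x = A x - lam *: x by [].
have Tg : cancel g T by move=> y; rewrite TE gK.
have gT : cancel T g.
  move=> x; apply/eqP; rewrite -subr_eq0 -normr_le0.
  rewrite -(pmulr_rle0 _ c0'); apply: le_trans (below _) _.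
  by rewrite -TE linearB Tg subrr normr0.
have glin : linear g := can2_linear gT Tg.
pose S : {linear V -> V} := HB.pack g (GRing.isLinear.Build _ _ _ _ g glin).
exists S; split => //; exists c^-1 => y /=.
rewrite -(ler_pM2l c0') mulrA -rmorphM/= divff ?gt_eqF// rmorph1 mul1r.
by have := below (g y); rewrite gK.
Qed.

Lemma spectrum_similar V W (A : V -> V) (L : W -> W)
    (T : {linear W -> V}) (Tinv : {linear V -> W}) :
  bounded_op T -> bounded_op Tinv -> cancel T Tinv -> cancel Tinv T ->
  (forall x, A x = T (L (Tinv x))) ->
  spectrum A `<=` spectrum L.
Proof.
move=> bT bTi TK TiK AE z + [S [bS SK KS]]; apply.
exists (T \o S \o Tinv : {linear V -> V}); split.
- by apply: bounded_op_comp => //; exact: bounded_op_comp.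
- by move=> x /=; rewrite AE linearB linearZ/= TK SK TiK.
- move=> x /=; rewrite AE TK.
  by rewrite -linearZ -linearB/= KS TiK.
Qed.

(** * Operators controlled by their eigenvalues *)

(** What the argument uses of a diagonal operator [L] with diagonal [l]: the
    [l i] are eigenvalues, and [L - z] is bounded below and onto as soon as the
    eigenvalues stay away from [z]. It holds for a diagonal matrix as well as
    for a bounded diagonal operator on a sequence space. *)
Definition eigenvalue_controlled V (I : Type) (l : I -> R[i]) (L : V -> V) :=
  [/\ forall i, exists2 e, e != 0 & L e = l i *: e,
      forall z (c : R), 0 <= c -> (forall i, c <= cabs (l i - z)) ->
        forall y, c%:C * `|y| <= `|L y - z *: y|
    & forall z (c : R), 0 < c -> (forall i, c <= cabs (l i - z)) ->
        forall w, exists y, L y - z *: y = w].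

(** With [lam] a closest point to [mu] in the closure of the eigenvalues,
    [L - mu] maps [Tinv x] to a vector of norm at least [|mu - lam| * |Tinv x|];
    that vector is [Tinv ((A - B) x)]. *)
Lemma bauer_fike V W (I : Type) (i0 : I) (l : I -> R[i]) (A B : V -> V)
    (L : {linear W -> W}) (T : {linear W -> V}) (Tinv : {linear V -> W}) :
  eigenvalue_controlled l L ->
  bounded_op T -> bounded_op Tinv -> cancel T Tinv -> cancel Tinv T ->
  (forall x, A x = T (L (Tinv x))) ->
  forall (mu : R[i]) (x : V), B x = mu *: x -> `|x| = 1 ->
  exists lam : R[i],
    [/\ spectrum A lam,
        forall nu, spectrum A nu -> `|mu - lam| <= `|mu - nu|
      & `|mu - lam| <= (opnorm T * opnorm Tinv)%:C * `|B x - A x| ].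
Proof.
move=> [eig below onto] bT bTi TK TiK AE mu x Bx x1.
have [lam [lamcl lammin]] := nearest_adherent_point i0 l mu.
exists lam; split.
- apply: approx_eigenvalue_spectrum => e e0.
  have [i /ltW lie] := lamcl e e0; have [v v0 Lv] := eig i.
  exists (T v).
    by apply: contra_neq v0 => Tv0; rewrite -(TK v) Tv0 linear0.
  by rewrite AE TK Lv linearZ/= -scalerBl normrZ ler_wpM2r// cabsE lecR.
- move=> nu /(spectrum_similar bT bTi TK TiK AE) Lnu.
  rewrite !cabsE lecR leNgt; apply/negP => lt_nu.
  (* By the triangle inequality no [l i] is within [c] of [nu]. *)
  pose c := cabs (mu - lam) - cabs (mu - nu).
  have c0 : 0 < c by rewrite subr_gt0.
  have cl i : c <= cabs (l i - nu).
    rewrite lerBlDr (le_trans (lammin i))// -[cabs (l i - nu)]cabsN opprB.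
    rewrite [leRHS]addrC; have := cabsD (mu - nu) (nu - l i).
    by rewrite addrA subrK.
  apply: (bounded_below_onto_not_spectrum c0 _ _ Lnu).
    exact: below (ltW c0) cl.
  exact: onto c0 cl.
- have lo : `|mu - lam| * `|Tinv x| <= `|Tinv (B x - A x)|.
    have -> : Tinv (B x - A x) = - (L (Tinv x) - mu *: Tinv x).
      by rewrite linearB Bx AE TK linearZ/= opprB.
    rewrite normrN cabsE; apply: below (cabs_ge0 _) _ _ => i.
    rewrite -[cabs (l i - mu)]cabsN opprB; exact: lammin.
  have hi : 1 <= (opnorm T)%:C * `|Tinv x|.
    by rewrite -x1 -{1}(TiK x); exact: opnormP.
  apply: (@le_trans _ _ (`|mu - lam| * ((opnorm T)%:C * `|Tinv x|))).
    by rewrite -[leLHS]mulr1 ler_wpM2l.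
  rewrite mulrCA rmorphM/= -mulrA ler_wpM2l ?lecR ?(opnorm_ge0 bT)//.
  exact: le_trans lo (opnormP bTi _).
Qed.

End BoundedOperators.

(** * Diagonal matrices *)

Section DiagonalMatrix.
Context {R : realType} (d : nat).
Implicit Types x y : Cvec R d.

Lemma Cvec_norm_le_coord (c : R) x y : 0 <= c ->
  (forall i, c * cabs (x i 0) <= cabs (y i 0)) -> c%:C * `|x| <= `|y|.
Proof.
move=> c0 cxy; rewrite !Cvec_normE -rmorphM/= lecR.
rewrite -[c in leLHS]ger0_norm// -sqrtr_sqr -sqrtrM ?sqr_ge0// ler_wsqrtr//.
rewrite mulr_sumr ler_sum// => i _; rewrite -exprMn.
by rewrite lerXn2r ?nnegrE ?mulr_ge0 ?cabs_ge0.
Qed.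

Lemma diag_mx_eigenvalue_controlled (Lam : 'M[R[i]]_d)
    (L : {linear Cvec R d -> Cvec R d}) :
  is_diag_mx Lam -> (forall x, L x = Lam *m x) ->
  eigenvalue_controlled (fun i => Lam i i) L.
Proof.
move=> /is_diag_mxP diagL LE.
have LC x i : L x i 0 = Lam i i * x i 0.
  rewrite LE mxE (bigD1 i)//= big1 ?addr0// => j ji.
  by rewrite diagL ?mul0r// eq_sym.
have LzC z x i : (L x - z *: x) i 0 = (Lam i i - z) * x i 0.
  have -> : (L x - z *: x) i 0 = L x i 0 - z * x i 0 by rewrite !mxE.
  by rewrite LC mulrBl.
split.
- move=> i; exists (delta_mx i 0 : Cvec R d).
    apply/eqP => /matrixP/(_ i 0); rewrite !mxE !eqxx/= => /eqP.
    by rewrite oner_eq0.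
  apply/colP => j; rewrite LC !mxE.
  by case: eqVneq => [->//|_]; rewrite !mulr0.
- move=> z c c0 cl y; apply: Cvec_norm_le_coord => // i.
  by rewrite LzC cabsM ler_wpM2r ?cabs_ge0.
- move=> z c c0 cl w; exists (\col_i ((Lam i i - z)^-1 * w i 0)).
  apply/colP => i; rewrite LzC mxE mulVKf//.
  apply: contraTneq (lt_le_trans c0 (cl i)) => ->.
  by rewrite /cabs normr0 ltxx.
Qed.

End DiagonalMatrix.

(** * Diagonal operators on square-summable sequences *)

Section DiagonalL2.
Context {R : realType}.
Implicit Types x y : l2 R.

Let psum (x : nat -> R[i]) := series (fun k => cabs (x k) ^+ 2).

Let psum_nd x : nondecreasing_seq (psum x).
Proof. by apply: nondecreasing_series => n _ _; exact: sqr_ge0. Qed.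

Let psum_cvg x : cvgn (psum x).
Proof. by have := l2_seqP x; rewrite unfold_in => /asboolP. Qed.

Let psum_le x n : psum x n <= limn (psum x).
Proof. apply: nondecreasing_cvgn_le; [exact: psum_nd | exact: psum_cvg]. Qed.

Lemma l2_norm_le_coord (c : R) x y : 0 <= c ->
  (forall k, c * cabs (x k) <= cabs (y k)) -> c%:C * `|x| <= `|y|.
Proof.
move=> c0 cxy; rewrite !l2_normE -rmorphM/= lecR.
rewrite -[c in leLHS]ger0_norm// -sqrtr_sqr -sqrtrM ?sqr_ge0// ler_wsqrtr//.
rewrite -[_ * _]/(_ *: _) -limZr; last exact: psum_cvg.
apply: ler_lim; [by apply: is_cvgZr; exact: psum_cvg | exact: psum_cvg |].
apply: nearW => n; rewrite [leLHS]mulr_sumr ler_sum// => k _.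
by rewrite -exprMn lerXn2r ?nnegrE ?mulr_ge0 ?cabs_ge0.
Qed.

Lemma l2_coord_le_norm x k : cabs (x k) <= complex.Re `|x|.
Proof.
rewrite l2_normE/= -[leLHS]ger0_norm ?cabs_ge0// -sqrtr_sqr ler_wsqrtr//.
apply: le_trans _ (psum_le x k.+1).
rewrite /psum /series/= big_nat_recr//= lerDr sumr_ge0// => i _.
exact: sqr_ge0.
Qed.

Definition l2_trunc n x : l2 R := \sum_(i < n) x i *: l2_delta R i.

Lemma l2_truncE n x k : l2_trunc n x k = if (k < n)%N then x k else 0.
Proof.
elim: n => [|n IH]; first by rewrite /l2_trunc big_ord0.
rewrite /l2_trunc big_ord_recr/= -/(l2_trunc n x).
rewrite [LHS](_ : _ = l2_trunc n x k + x n * (k == n)%:R)//.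
rewrite IH ltnS [(k <= n)%N]leq_eqVlt; case: eqVneq => [->|_]/=.
  by rewrite ltnn mulr1 add0r.
by rewrite mulr0 addr0.
Qed.

(** The squared norm of a tail is the defect of a partial sum from the sum. *)
Lemma l2_trunc_cvg x (e : R) : 0 < e ->
  \forall n \near \oo, complex.Re `|x - l2_trunc n x| < e.
Proof.
move=> e0; have : psum x @ \oo --> limn (psum x) by exact: psum_cvg.
move=> /cvgrPdist_lt /(_ (e ^+ 2)); rewrite exprn_gt0// => /(_ isT).
apply: filterS => n.
have yE k : (x - l2_trunc n x) k = if (k < n)%N then 0 else x k.
  rewrite [LHS](_ : _ = x k - l2_trunc n x k)// l2_truncE.
  by case: ifP; rewrite (subrr, subr0).
move: (x - l2_trunc n x) yE => y yE.
rewrite ger0_norm ?subr_ge0 ?(nondecreasing_cvgn_le (psum_nd x))// => tail.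
rewrite l2_normE/= -[ltRHS]ger0_norm ?ltW// -sqrtr_sqr ltr_sqrt ?exprn_gt0//.
apply: le_lt_trans tail.
suff le_y N : psum y N <= limn (psum x) - psum x n.
  apply: limr_le; first exact: psum_cvg.
  by apply: nearW => N; exact: le_y.
rewrite lerBrDr; apply: le_trans (psum_le x (n + N)).
(* Enlarge the range to [n + N], so that it splits at [n]. *)
apply: (@le_trans _ _ (psum y (n + N) + psum x n)).
  by rewrite lerD2r; apply: psum_nd; exact: leq_addl.
rewrite /psum /series/= !(big_cat_nat (leq0n n) (leq_addr N n))/=.
rewrite [X in X + _ + _]big_nat big1 ?add0r => [|k /andP[_ kn]]; last first.
  by rewrite yE kn /cabs normr0 expr0n.
rewrite [leLHS]addrC lerD2l big_nat [leRHS]big_nat ler_sum// => k /andP[nk _].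
by rewrite yE ltnNge nk.
Qed.

(** The hypothesis only speaks of the basis vectors; boundedness carries the
    formula from finite sums to their limits. *)
Lemma l2_diagonal_coord (L : {linear l2 R -> l2 R}) (l : nat -> R[i]) :
  bounded_op L -> (forall j, L (l2_delta R j) = l j *: l2_delta R j) ->
  forall x k, L x k = l k * x k.
Proof.
move=> /bounded_op_ge0[M M0 LM] Ll x k.
have Ltrunc n : (k < n)%N -> L (l2_trunc n x) k = l k * x k.
  move=> kn; rewrite /l2_trunc linear_sum.
  rewrite (eq_bigr (fun i : 'I_n => (l i * x i) *: l2_delta R i)); last first.
    by move=> i _; rewrite linearZ/= Ll scalerA mulrC.
  have : (\sum_(i < n) (l i * x i) *: l2_delta R i : l2 R) k =
     \sum_(i < n) l i * x i * (k == i)%:R.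
    by elim/big_ind2: _ => // ? ? ? ? <- <-.
  move=> ->; rewrite (bigD1 (Ordinal kn))//= eqxx mulr1 big1 ?addr0// => i ik.
  case: eqVneq => [ki|_]; last by rewrite mulr0.
  by case/eqP: ik; apply/val_inj.
apply/eqP; rewrite -subr_eq0; apply/eqP/cabs_eq0/eqP.
rewrite eq_le cabs_ge0 andbT; apply/ler_addgt0Pr => e e0; rewrite add0r.
(* For [n > k] the difference is the [k]-th coordinate of [L] applied to the
   tail [x - l2_trunc n x], hence at most [M] times the norm of that tail. *)
have e1 : 0 < e / (M + 1) by rewrite divr_gt0// ltr_wpDl.
near \oo => n.
have kn : (k < n)%N by near: n; exact: nbhs_infty_gt.
rewrite -(Ltrunc n kn) -[_ - _]/((L x - L (l2_trunc n x)) k) -linearB.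
apply: le_trans (l2_coord_le_norm _ _) _; rewrite -lecR -norm_ReE.
apply: le_trans (LM _) _; rewrite norm_ReE -rmorphM/= lecR.
apply: (@le_trans _ _ (M * (e / (M + 1)))).
  rewrite ler_wpM2l// ltW//; near: n; exact: l2_trunc_cvg.
by rewrite mulrCA ler_piMr ?(ltW e0)// ler_pdivrMr ?ltr_wpDl// mul1r lerDl.
Unshelve. all: end_near. Qed.

Lemma square_summable_le_coord (c : R) (u : nat -> R[i]) x : 0 < c ->
  (forall k, c * cabs (u k) <= cabs (x k)) -> u \in @square_summable R.
Proof.
move=> c0 cux; rewrite unfold_in; apply/asboolP.
apply: (@series_le_cvg _ _ (fun k => (c^-1) ^+ 2 * cabs (x k) ^+ 2)).
- by move=> k; exact: sqr_ge0.
- by move=> k; rewrite mulr_ge0 ?sqr_ge0.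
- move=> k; rewrite -exprMn.
  rewrite lerXn2r ?nnegrE ?mulr_ge0 ?invr_ge0 ?cabs_ge0 ?(ltW c0)//.
  by rewrite ler_pdivlMl.
- rewrite (_ : series _ = (c^-1 ^+ 2) *: psum x).
    by apply: is_cvgZr; exact: psum_cvg.
  by apply/funext => n; rewrite /series/= -mulr_sumr.
Qed.

Lemma l2_diagonal_eigenvalue_controlled (L : {linear l2 R -> l2 R})
    (l : nat -> R[i]) :
  bounded_op L -> (forall j, L (l2_delta R j) = l j *: l2_delta R j) ->
  eigenvalue_controlled l L.
Proof.
move=> bL Ll; have LC := l2_diagonal_coord bL Ll.
have LzC z x k : (L x - z *: x) k = (l k - z) * x k.
  by rewrite mulrBl -LC.
split.
- move=> j; exists (l2_delta R j) => //.
  apply/eqP => /(congr1 (fun x : l2 R => x j)) /=.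
  by rewrite eqxx => /eqP; rewrite oner_eq0.
- move=> z c c0 cl y; apply: l2_norm_le_coord => // k.
  by rewrite [X in _ <= cabs X](LzC z y k) cabsM ler_wpM2r ?cabs_ge0.
- move=> z c c0 cl w.
  have lz k : l k - z != 0.
    apply: contraTneq (lt_le_trans c0 (cl k)) => ->.
    by rewrite /cabs normr0 ltxx.
  have us : (fun k => (l k - z)^-1 * w k) \in @square_summable R.
    apply: (@square_summable_le_coord c _ w) => // k.
    rewrite -[w k in leRHS](mulVKf (lz k)) [leRHS]cabsM.
    by rewrite ler_wpM2r ?cabs_ge0.
  exists (L2 us); apply/val_inj/funext => k.
  by rewrite [LHS](LzC z (L2 us) k)/= mulVKf.
Qed.

End DiagonalL2.

Theorem theorem11 (R : realType) (X : hilbertType R) :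
  (separable X -> ~ finite_dimensional X ->
   forall (A B : {linear X -> X})
     (V : {linear l2 R -> X}) (Vinv : {linear X -> l2 R})
     (Lam : {linear l2 R -> l2 R}),
   bounded_op A -> bounded_op B ->
   bounded_op V -> bounded_op Vinv -> cancel V Vinv -> cancel Vinv V ->
   bounded_op Lam -> l2_diagonal Lam ->
   (forall x, A x = V (Lam (Vinv x))) ->
   forall (mu : R[i]) (x : X), B x = mu *: x -> `|x| = 1 ->
   exists lam : R[i],
     [/\ spectrum A lam,
         forall nu, spectrum A nu -> `|mu - lam| <= `|mu - nu|
       & `|mu - lam| <= (opnorm V * opnorm Vinv)%:C * `|B x - A x| ])
  /\
  (forall d : nat,
   (exists T : {linear Cvec R d -> X}, bijective T) ->
   forall (A B : {linear X -> X})
     (V : {linear Cvec R d -> X}) (Vinv : {linear X -> Cvec R d})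
     (Lam : 'M[R[i]]_d),
   bounded_op A -> bounded_op B ->
   bounded_op V -> bounded_op Vinv -> cancel V Vinv -> cancel Vinv V ->
   is_diag_mx Lam ->
   (forall x, A x = V (Lam *m Vinv x)) ->
   forall (mu : R[i]) (x : X), B x = mu *: x -> `|x| = 1 ->
   exists lam : R[i],
     [/\ spectrum A lam,
         forall nu, spectrum A nu -> `|mu - lam| <= `|mu - nu|
       & `|mu - lam| <= (opnorm V * opnorm Vinv)%:C * `|B x - A x| ]).
Proof.
split.
  move=> _ _ A B V Vinv Lam _ _ bV bVi VK ViK bL /choice[l Ll] AE.
  exact: (bauer_fike 0%N (l2_diagonal_eigenvalue_controlled bL Ll)
            bV bVi VK ViK AE).
move=> d _ A B V Vinv Lam _ _ bV bVi VK ViK diagL AE mu x Bx x1.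
case: d V Vinv Lam bV bVi VK ViK diagL AE => [|d] V Vinv Lam bV bVi VK ViK.
  (* In dimension 0 there is no eigenvalue, but no unit vector either. *)
  move=> _ _; have x0 : x = 0.
    rewrite -(ViK x) (_ : Vinv x = 0) ?linear0//.
    by apply/colP; case.
  by move: x1 => /eqP; rewrite x0 normr0 eq_sym oner_eq0.
move=> diagL AE.
pose L : {linear Cvec R d.+1 -> Cvec R d.+1} :=
  HB.pack (fun y : Cvec R d.+1 => Lam *m y : Cvec R d.+1)
    (GRing.isLinear.Build _ _ _ _ _
      (linearP (mulmx Lam : {linear _ -> 'cV_d.+1}))).
have Lctrl := diag_mx_eigenvalue_controlled diagL (L := L) (fun=> erefl).
exact: (bauer_fike ord0 Lctrl bV bVi VK ViK AE Bx x1).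
Qed.
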